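(* Let $Z\colon\mathbb{R}^n\to\mathbb{R}^m$ be a jointly measurable random map. Assume that $\mu\in\mathcal{P}_c(\mathbb{R}^n)$ and $A\subset\mathbb{R}^n$ is an analytic set. Then, almost surely, $$\dim_P \mu_Z\ge \dim_{P,Z}\mu \quad\text{and}\quad \dim_P Z(A)\ge \dim_{P,Z} A.$$
   Context: A random map $Z\colon\mathbb{R}^n\to\mathbb{R}^m$ on a probability space $(\Omega,\mathcal{F},\mathbb{P})$ is jointly measurable if $Z\colon\mathbb{R}^n\times\Omega\to\mathbb{R}^m$ is measurable from $\mathcal{B}(\mathbb{R}^n)\otimes\mathcal{F}$ to $\mathcal{B}(\mathbb{R}^m)$. $\mathcal{P}_c(A)$ is the set of Borel probability measures with compact support contained in $A$; $\mu_Z=\mu\circ Z^{-1}$. $\dim_P$ of a set is packing dimension; for a Borel probability measure $\nu$ on $\mathbb{R}^m$, $\dim_P\nu=\inf\{\dim_P E: E \text{ Borel}, \nu(E)>0\}$. $B(x,r)$ is the closed Euclidean ball. For $\mu\in\mathcal{P}_c(\mathbb{R}^n)$, $$\dim_{P,Z}\mu=\sup\Big\{\gamma:\ \liminf_{r\to0+} r^{-\gamma}\,\mathbb{E}\big(\mu_Z(B(Z(t),r))\big)=0 \text{ for } \mu\text{-a.e. } t\Big\},$$ and $\dim_{P,Z}A=\sup\{\dim_{P,Z}\mu:\mu\in\mathcal{P}_c(A)\}$. *)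

(* Defs.v *)
From HB Require Import structures.
From mathcomp Require Import all_boot all_order all_algebra.
From mathcomp Require Import all_classical all_reals all_analysis.
Set Implicit Arguments. Unset Strict Implicit. Unset Printing Implicit Defensive.
Import Order.TTheory GRing.Theory Num.Theory.
Import numFieldNormedType.Exports.
Local Open Scope classical_set_scope.
Local Open Scope ring_scope.

Notation Rn R n := (g_sigma_algebraType (@open 'rV[R]_n)).

Section Defs.
Variable R : realType.
Local Notation Rn n := (Rn R n).

Definition edist (n : nat) (x y : 'rV[R]_n) : R :=
  Num.sqrt (\sum_(i < n) (x ord0 i - y ord0 i) ^+ 2).
Definition cball (n : nat) (x : 'rV[R]_n) (r : R) : set 'rV[R]_n :=
  [set y | edist x y <= r].

Definition supp (n : nat) (mu : set (Rn n) -> \bar R) : set 'rV[R]_n :=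
  [set x | forall r : R, 0 < r -> (0 < mu (cball x r : set (Rn n)))%E].

Definition Pc (n : nat) (A : set 'rV[R]_n) : set (probability (Rn n) R) :=
  [set mu | compact (supp mu) /\ supp mu `<=` A].

Definition analytic (n : nat) (A : set 'rV[R]_n) : Prop :=
  A = set0 \/ exists f : {ptws nat -> nat} -> 'rV[R]_n,
    continuous f /\ A = range f.

Definition coverable (m : nat) (E : set 'rV[R]_m) (d : R) (k : nat) : Prop :=
  exists c : 'I_k -> 'rV[R]_m, E `<=` \bigcup_(i in [set: 'I_k]) cball (c i) d.

(* upper box dimension: limsup_{d->0+} log N_d(E) / (- log d),
   written as inf { s >= 0 : N_d(E) <= d^(-s) for all small d > 0 }
   (+oo when E is unbounded). *)
Definition ubox_dim (m : nat) (E : set 'rV[R]_m) : \bar R :=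
  ereal_inf [set s%:E | s in [set s : R | 0 <= s /\
    exists d0 : R, 0 < d0 /\ forall d : R, 0 < d < d0 ->
      exists k : nat, k%:R <= d `^ (- s) /\ coverable E d k]].

(* packing dimension of a set (modified upper box dimension) *)
Definition dimP (m : nat) (E : set 'rV[R]_m) : \bar R :=
  ereal_inf [set ereal_sup (range (fun i => ubox_dim (F i))) |
    F in [set F : nat -> set 'rV[R]_m | E `<=` \bigcup_i F i]].

Definition dimP_meas (m : nat) (nu : set (Rn m) -> \bar R) : \bar R :=
  ereal_inf [set dimP E | E in [set E : set (Rn m) | measurable E /\ (0 < nu E)%E]].

Section RandomMap.
Context (d : measure_display) (Omega : measurableType d) (P : probability Omega R).

Definition exp_ball (n m : nat) (Z : Rn n -> Omega -> Rn m)
    (mu : set (Rn n) -> \bar R) (t : Rn n) (r : R) : \bar R :=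
  (\int[P]_w pushforward mu (Z ^~ w) (cball (Z t w : 'rV[R]_m) r : set (Rn m)))%E.

Definition dimPZ (n m : nat) (Z : Rn n -> Omega -> Rn m)
    (mu : probability (Rn n) R) : \bar R :=
  ereal_sup [set g%:E | g in [set g : R | {ae mu, forall t,
     limf_einf (fun r : R => ((r `^ (- g))%:E * exp_ball Z mu t r)%E) (0%R^'+)
       = 0%E}]].

Definition dimPZ_set (n m : nat) (Z : Rn n -> Omega -> Rn m)
    (A : set 'rV[R]_n) : \bar R :=
  ereal_sup [set dimPZ Z mu | mu in Pc A].

End RandomMap.
End Defs.

(* Main.v *)
(* Fix [g] admissible in the supremum defining [dimPZ]. Along dyadic radii, Fatou
   and Tonelli give, almost surely, [liminf r^(-g) mu_Z(B(Z(t),r)) = 0] for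
   [mu]-a.e. [t]. On the other hand a set of upper box dimension [< g] is covered
   by at most [r^(-s)] balls of radius [r], with [s < g]; those of mass below
   [r^g] have total mass at most [r^(g-s)], so by Borel-Cantelli almost all points
   [z] of the set satisfy [mu_Z(B(z,2r)) >= r^g] for all small dyadic [r]. Hence
   countably many such sets cannot cover the image of a set of positive measure.
   For [Z(A)], apply this to a measurable conull subset of [supp mu]. *)
Require Import Defs.
From HB Require Import structures.
From mathcomp Require Import all_boot all_order all_algebra.
From mathcomp Require Import all_classical all_reals all_analysis.
From mathcomp Require Import measurable_realfun lra.
Import Order.TTheory GRing.Theory Num.Theory.
Import numFieldNormedType.Exports.
Local Open Scope classical_set_scope.
Local Open Scope ereal_scope.
Local Notation edist := Defs.edist.

(** * Euclidean balls: comparison of distances and measurability *)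

Section euclidean_distance.
Context {R : realType} {m : nat}.
Implicit Types (x y z : 'rV[R]_m).

Lemma edist_ge0 x y : (0 <= edist x y)%R.
Proof. exact: sqrtr_ge0. Qed.

Lemma edistC x y : edist x y = edist y x.
Proof.
by congr Num.sqrt; apply: eq_bigr => i _; rewrite -sqrrN opprB.
Qed.

Lemma edist_le x y (r : R) : (0 <= r)%R ->
  (edist x y <= r)%R = (\sum_(i < m) (x ord0 i - y ord0 i) ^+ 2 <= r ^+ 2)%R.
Proof.
move=> r0; rewrite -[in LHS](ger0_norm r0) -sqrtr_sqr /edist ler_sqrt//.
exact: sqr_ge0.
Qed.

(** Coordinatewise, (a - c)^2 <= 2 ((a - b)^2 + (b - c)^2), since the difference of the two sides is
    (a - 2b + c)^2. Summing bounds the squared distance by 4 r^2. *)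
Lemma edist_le_double x y z (r : R) :
  (edist x y <= r)%R -> (edist y z <= r)%R -> (edist x z <= 2 * r)%R.
Proof.
move=> xy yz; have r0 : (0 <= r)%R := le_trans (edist_ge0 x y) xy.
move: xy yz; rewrite !edist_le ?mulr_ge0// => xy yz.
have {xy yz} := lerD xy yz; rewrite -big_split/= => le2.
apply: (@le_trans _ _ (2 * (r ^+ 2 + r ^+ 2))%R); last by rewrite exprMn; lra.
apply: le_trans (ler_wpM2l _ le2) => //; rewrite mulr_sumr.
apply: ler_sum => i _.
set a := x _ _; set b := y _ _; set c := z _ _.
have := sqr_ge0 (a - 2 * b + c); nra.
Qed.

(** The sum of [m] squares is at most m (r / (m + 1))^2 <= r^2; dividing by [m.+1] also covers
    [m = 0]. *)
Lemma edist_le_coord x y (r : R) : (0 < r)%R ->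
  (forall i, `|x ord0 i - y ord0 i| <= r / (m.+1)%:R)%R -> (edist x y <= r)%R.
Proof.
move=> r0 xy; rewrite (edist_le _ _ _ (ltW r0)).
have mge1 : (1 <= m.+1%:R :> R)%R by rewrite ler1n.
apply: (@le_trans _ _ (\sum_(i < m) (r / m.+1%:R) ^+ 2)%R).
  apply: ler_sum => i _; rewrite -real_normK ?num_real// lerXn2r ?nnegrE//.
  by rewrite divr_ge0 ?(ltW r0).
rewrite sumr_const card_ord -[leLHS]mulr_natl exprMn exprVn.
rewrite mulrCA ler_piMr ?sqr_ge0// ler_pdivrMr ?exprn_gt0 ?ltr0n//.
rewrite mul1r expr2 (@le_trans _ _ m.+1%:R%R)// ?ler_nat//.
by rewrite ler_peMl.
Qed.

Lemma dense_rat_edist x (r : R) : (0 < r)%R ->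
  exists c : 'rV[rat]_m, (edist (map_mx ratr c) x <= r)%R.
Proof.
move=> r0; pose e := (r / m.+1%:R)%R.
have e0 : (0 < e)%R by rewrite divr_gt0.
have near_rat i : exists q : rat, (`|ratr q - x ord0 i| <= e)%R.
  have : (x ord0 i < x ord0 i + e)%R by rewrite ltrDl.
  move=> /rat_in_itvoo[q]; rewrite in_itv/= => /andP[? ?]; exists q.
  by rewrite ler_norml; lra.
have [f fP] := choice near_rat.
exists (\row_i f i)%R; apply: edist_le_coord => // i.
by rewrite !mxE.
Qed.

Lemma measurable_coord (i : 'I_m) :
  measurable_fun [set: Rn R m] (fun x : Rn R m => (x : 'rV[R]_m) ord0 i).
Proof.
apply: (measurability _ (RGenOInfty.measurableE R)) => _ [_ [a ->] <-].
rewrite setTI; apply: sub_sigma_algebra.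
by apply: open_comp; [move=> x _; exact: coord_continuous|exact: interval_open].
Qed.

Lemma measurable_edist {d : measure_display} {T : measurableType d}
    (f g : T -> Rn R m) :
  measurable_fun [set: T] f -> measurable_fun [set: T] g ->
  measurable_fun [set: T] (fun t => edist (f t : 'rV[R]_m) (g t : 'rV[R]_m)).
Proof.
move=> mf mg.
apply: (@measurableT_comp _ _ _ _ _ _ (@Num.sqrt R)).
  by apply: continuous_measurable_fun; exact: sqrt_continuous.
apply: measurable_sum => i; apply: measurable_funX.
by apply: measurable_funB; exact: (measurableT_comp (measurable_coord i)).
Qed.

Lemma measurable_cball x (r : R) : measurable (cball x r : set (Rn R m)).
Proof.
have mx := measurable_edist (fun=> x : Rn R m) id (measurable_cst _)
  (@measurable_id _ _ _).
rewrite -[X in measurable X]setTI.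
have := mx measurableT _ (measurable_itv `]-oo, r]%R).
by congr (measurable (setT `&` _)); apply/seteqP; split => y /=; rewrite in_itv.
Qed.

End euclidean_distance.

(** * Lower limits at zero along real and dyadic radii *)

Section limit_inferior.
Context {R : realType}.

Lemma limn_einf_eq0P (u : (\bar R)^nat) : (forall k, 0 <= u k) ->
  limn_einf u = 0 <->
  forall (K : nat) (e : R), (0 < e)%R -> exists2 k, (K <= k)%N & u k < e%:E.
Proof.
move=> u0; rewrite limn_einf_lim (cvg_lim _ (@cvg_einfs_sup _ u))//.
split=> [u_eq0 K e e0|u_small].
  have : einfs u K < e%:E.
    apply: (@le_lt_trans _ _ 0); last by rewrite lte_fin.
    by rewrite -u_eq0; apply: ereal_sup_ubound; exists K.
  by move=> /ereal_inf_lt[_ [k/= Kk <-] ue]; exists k.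
apply/eqP; rewrite eq_le; apply/andP; split.
  apply: ge_ereal_sup => _ [K _ <-].
  apply/lee_addgt0Pr => e e0; rewrite add0e.
  have [k Kk /ltW uke] := u_small K e e0.
  by apply: le_trans uke; apply: ereal_inf_lbound; exists k.
apply: le_trans (ereal_sup_ubound _); last by exists 0%N.
by apply: le_ereal_inf_tmp => _ [k _ <-].
Qed.

Lemma limf_einf_right_eq0 (f : R -> \bar R) : limf_einf f (0%R^'+) = 0 ->
  forall e r : R, (0 < e)%R -> (0 < r)%R ->
  exists2 s, (0 < s < r)%R & f s < e%:E.
Proof.
rewrite limf_einfE => f0 e r e0 r0.
have : ereal_inf (f @` [set s | (0 < s < r)%R]) < e%:E.
  apply: (@le_lt_trans _ _ 0); last by rewrite lte_fin.
  rewrite -f0; apply: ereal_sup_ubound.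
  exists [set s | (0 < s < r)%R] => //.
  near=> s => /=; apply/andP; split; near: s.
    exact: nbhs_right_gt.
  exact: nbhs_right_lt.
by move=> /ereal_inf_lt[_ [s /= sr <-] fs]; exists s.
Unshelve. all: by end_near. Qed.

Lemma half_pow_gt0 (k : nat) : (0 < 2^-1 ^+ k :> R)%R.
Proof. by rewrite exprn_gt0// invr_gt0. Qed.

Lemma half_pow_lt (r : R) : (0 < r)%R ->
  exists K, forall k, (K <= k)%N -> (2^-1 ^+ k < r)%R.
Proof.
move=> r0.
have half_lt1 : (`|2^-1 : R| < 1)%R by rewrite ger0_norm ?invr_ge0//; lra.
have [K _ KP] := (@cvgrPdist_lt _ _ _ _ _ _ _).1 (cvg_geometric 1 half_lt1) r r0.
exists K => k /KP; rewrite /geometric/= mul1r sub0r normrN ger0_norm//.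
Qed.

Lemma half_pow_bracket (r : R) : (0 < r < 1)%R ->
  exists k, (2^-1 ^+ k.+1 <= r < 2^-1 ^+ k)%R.
Proof.
move=> /andP[r0 r1].
have exk : exists k, (2^-1 ^+ k <= r)%R.
  by have [K KP] := half_pow_lt r r0; exists K; exact/ltW/KP.
case: (ex_minnP exk) => -[|k] kr kmin.
  by move: kr; rewrite expr0 leNgt r1.
exists k; rewrite kr/= ltNge; apply/negP => /kmin.
by rewrite ltnn.
Qed.

(* Replacing [r] by the largest power of 1/2 below it decreases [phi] and
   costs at most the factor [2 `^ g] in [r `^ (- g)]. *)
Lemma dyadic_limn_einf (g : R) (phi : R -> \bar R) :
  (0 <= g)%R -> (forall r, 0 <= phi r) ->
  {homo phi : r s / (r <= s)%R >-> r <= s} ->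
  limf_einf (fun r => (r `^ (- g))%:E * phi r) (0%R^'+) = 0 ->
  limn_einf (fun k => ((2^-1 ^+ k) `^ (- g))%:E * phi (2^-1 ^+ k)%R) = 0.
Proof.
move=> g0 phi0 phi_le phi_lim.
apply/limn_einf_eq0P => [k|K e e0]; first by rewrite mule_ge0// lee_fin powR_ge0.
have c0 : (0 < 2 `^ g :> R)%R by rewrite powR_gt0.
have [r /andP[r0 rK] phir] := limf_einf_right_eq0 _ phi_lim (e / 2 `^ g)
  (2^-1 ^+ K)%R (divr_gt0 e0 c0) (half_pow_gt0 K).
have r1 : (r < 1)%R.
  by apply: lt_le_trans rK _; rewrite exprn_ile1 ?invr_ge0 ?invf_le1 ?ler1n.
have [k /andP[kr rk]] : exists k, (2^-1 ^+ k.+1 <= r < 2^-1 ^+ k)%R.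
  by apply: half_pow_bracket; rewrite r0.
exists k.+1.
  rewrite leqNgt; apply/negP => kK; have := le_lt_trans kr rK.
  rewrite ltNge ler_wiXn2l ?invr_ge0 ?invf_le1 ?ler1n//; exact: ltnW.
apply: (@le_lt_trans _ _ ((2 `^ g)%:E * ((r `^ (- g))%:E * phi r))).
  rewrite muleA -EFinM lee_pmul ?lee_fin ?powR_ge0 ?phi_le//.
  (* The factor 2^g turns r^(-g) into (r / 2)^(-g); as r / 2 < 2^(-k-1) and g >= 0, this dominates
     the dyadic weight. *)
  have -> : (2 `^ g * r `^ (- g) = (r / 2) `^ (- g) :> R)%R.
    rewrite powRM ?invr_ge0 ?(ltW r0)//.
    by rewrite -powR_inv1// -powRrM mulN1r opprK mulrC.
  rewrite !powRN lef_pV2 ?posrE ?powR_gt0 ?divr_gt0 ?half_pow_gt0//.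
  rewrite ge0_ler_powR ?nnegrE ?divr_ge0 ?(ltW r0) ?(ltW (half_pow_gt0 _))//.
  by rewrite exprSr ler_pM2r ?invr_gt0 ?(ltW rk).
by move: phir; rewrite mulrC EFinM lte_pdivlMl.
Qed.

End limit_inferior.

(** * Lower density on sets of small box dimension, and packing dimension of images *)

Section packing_dimension.
Context {R : realType} {d : measure_display} {T : measurableType d}.
Variable mu : probability T R.

Lemma nneseries_geometric_lty (a q : R) (u : (\bar R)^nat) :
  (0 <= a)%R -> (0 < q < 1)%R ->
  (forall k, 0 <= u k <= (a * q ^+ k)%:E) -> \sum_(k <oo) u k < +oo.
Proof.
move=> a0 /andP[q0 q1] u_le.
apply: (@le_lt_trans _ _ (a / (1 - q))%:E); last exact: ltry.
apply: lime_le; first by apply: is_cvg_nneseries => k _ _; case/andP: (u_le k).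
near=> N.
apply: (@le_trans _ _ (\sum_(0 <= k < N) (a * q ^+ k)%:E)).
  by apply: lee_sum => k _; case/andP: (u_le k).
by rewrite sumEFin lee_fin geometric_le_lim// ger0_norm// ltW.
Unshelve. all: by end_near. Qed.

Lemma half_pow_powR (e : R) (k : nat) :
  ((2^-1 ^+ k) `^ e = (2^-1 `^ e) ^+ k :> R)%R.
Proof.
by rewrite -powR_mulrn ?invr_ge0// -powRrM mulrC powRrM powR_mulrn// powR_ge0.
Qed.

Lemma measure_bigsetU_le {I : Type} (s : seq I) (P : pred I) (A : I -> set T) :
  (forall i, measurable (A i)) ->
  mu (\big[setU/set0]_(i <- s | P i) A i) <= \sum_(i <- s | P i) mu (A i).
Proof.
move=> mA; elim: s => [|i s IHs]; first by rewrite !big_nil measure0.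
rewrite !big_cons; case: ifPn => // _.
apply: le_trans (leeD2l _ IHs); apply: measureU2 => //.
by apply: bigsetU_measurable => j _.
Qed.

Context {m : nat}.
Variable f : T -> Rn R m.
Hypothesis mf : measurable_fun [set: T] f.

Local Notation preball x r := (f @^-1` (cball (x : 'rV[R]_m) r : set (Rn R m))).

Lemma measurable_preball (x : 'rV[R]_m) (r : R) : measurable (preball x r).
Proof.
by rewrite -[X in measurable X]setTI; apply: mf => //; exact: measurable_cball.
Qed.

(* [V] collects the covering balls of small mass: any point outside [V] lies in
   a covering ball of large mass, which its ball of radius [2 * r] contains. *)
Lemma coverable_small_balls (F : set 'rV[R]_m) (g s r : R) (N : nat) :
  (0 < r)%R -> (N%:R <= r `^ (- s))%R -> coverable F r N ->
  exists V : set T, [/\ measurable V, mu V <= (r `^ (g - s))%:E &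
    forall t, F (f t) -> ~ V t ->
      (r `^ g)%:E <= mu (preball (f t) (2 * r)%R)].
Proof.
move=> r0 Nr [c Fc].
pose small i := mu (preball (c i) r) < (r `^ g)%:E.
exists (\big[setU/set0]_(i < N | small i) preball (c i) r); split.
- by apply: bigsetU_measurable => i _; exact: measurable_preball.
- apply: le_trans (measure_bigsetU_le _ _ _ _) _.
    by move=> i; exact: measurable_preball.
  apply: (@le_trans _ _ (\sum_(i < N | small i) (r `^ g)%:E)).
    by apply: lee_sum => i /ltW.
  apply: (@le_trans _ _ (\sum_(i < N) (r `^ g)%:E)).
    rewrite [leRHS](bigID small)/= leeDl//.
    by apply: sume_ge0 => i _; rewrite lee_fin powR_ge0.
  (* [N] terms r^g with N <= r^(-s) add up to at most r^(g-s). *)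
  rewrite sumEFin lee_fin sumr_const card_ord -mulr_natl.
  rewrite [(g - s)%R]addrC powRD; last by rewrite (gt_eqF r0) implybT.
  by rewrite ler_wpM2r// powR_ge0.
- move=> t /Fc[i _ /= tci] notV.
  have /negP : ~ small i.
    by move=> si; apply: notV; rewrite (bigD1 i)//=; left.
  rewrite -leNgt => /le_trans; apply.
  apply: le_measure; rewrite ?inE; try exact: measurable_preball.
  move=> u /= ciu; apply: (@edist_le_double _ _ _ (c i)) => //.
  by rewrite edistC.
Qed.

(** Borel-Cantelli: the exceptional sets at the dyadic scales have measures bounded by a geometric
    series of ratio 2^(-(g-s)) < 1, so their upper limit is null; any other point lies in only
    finitely many of them. *)
Lemma ubox_dim_lower_density (F : set 'rV[R]_m) (g : R) : ubox_dim F < g%:E ->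
  exists V : set T, [/\ measurable V, mu V = 0 &
    forall t, F (f t) -> ~ V t -> exists K, forall k, (K <= k)%N ->
      ((2^-1 ^+ k) `^ g)%:E <= mu (preball (f t) (2 * 2^-1 ^+ k)%R)].
Proof.
move=> /ereal_inf_lt[_ [s [s0 [d0 [d0_gt0 Fcov]]] <-]]; rewrite lte_fin => sg.
have [K Kd0] := half_pow_lt d0 d0_gt0.
(* The shift by [K] puts every radius below [d0], where the covering bound holds. *)
have covk k : exists V : set T, [/\ measurable V,
    mu V <= ((2^-1 ^+ (k + K)) `^ (g - s))%:E &
    forall t, F (f t) -> ~ V t -> ((2^-1 ^+ (k + K)) `^ g)%:E <=
      mu (preball (f t) (2 * 2^-1 ^+ (k + K))%R)].
  have [|N [Nr FN]] := Fcov (2^-1 ^+ (k + K))%R.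
    by rewrite half_pow_gt0 Kd0// leq_addl.
  exact: (coverable_small_balls _ _ _ _ _ (half_pow_gt0 _) Nr FN).
have [V VP] := choice covk.
have mV k : measurable (V k) by case: (VP k).
exists (lim_sup_set V); split.
- apply: bigcap_measurable => // k _; apply: bigcup_measurable => j _.
  exact: mV.
- apply: lim_sup_set_cvg0 => //.
  pose q : R := (2^-1 `^ (g - s))%R.
  have q0 : (0 < q)%R by rewrite powR_gt0// invr_gt0.
  have q1 : (q < 1)%R.
    (* The bound 1 is rewritten as 1^(g-s), so that monotonicity of the power applies to 1/2 < 1. *)
    rewrite -[ltRHS]/((fun=> 1%R) (g - s)%R) -powR1.
    by rewrite gt0_ltr_powR ?nnegrE ?invr_ge0 ?subr_gt0// invf_lt1 ?ltr1n.
  apply: (nneseries_geometric_lty (q ^+ K)%R q); rewrite ?q0 ?exprn_ge0 ?(ltW q0)//.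
  move=> k; rewrite measure_ge0/= -exprD addnC -half_pow_powR.
  by case: (VP k).
- move=> t Ft; rewrite /lim_sup_set /bigcap/= => /existsNP[J /not_implyP[_ tV]].
  (* The point avoids [V j] for all j >= J, and [V j] belongs to the scale [j + K]. *)
  exists (J + K)%N => k JKk.
  have -> : k = (k - K + K)%N by rewrite subnK// (leq_trans _ JKk)// leq_addl.
  have [_ _] := VP (k - K)%N; apply => // Vt; apply: tV; exists (k - K)%N => //=.
  by rewrite leq_subRL ?(leq_trans _ JKk)// ?leq_addl// addnC.
Qed.

Lemma ubox_dim_ge0 (F : set 'rV[R]_m) : 0 <= ubox_dim F.
Proof. by apply: le_ereal_inf_tmp => _ [s [s0 _] <-]; rewrite lee_fin. Qed.

Lemma dimP_ge0 (F : set 'rV[R]_m) : 0 <= dimP F.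
Proof.
apply: le_ereal_inf_tmp => _ [G _ <-].
by apply: (le_trans (ubox_dim_ge0 (G 0%N))); apply: ereal_sup_ubound; exists 0%N.
Qed.

(** Positivity is asked of [E] and not of its image, which may fail to be Borel. If the bound
    failed, [E] would be covered by the null set of the hypothesis and the null sets attached to the
    pieces [F i]. *)
Lemma dimP_image_ge (g : R) (E : set T) :
  {ae mu, forall t, limn_einf (fun k => ((2^-1 ^+ k) `^ (- g))%:E *
     mu (preball (f t) (2^-1 ^+ k)%R)) = 0} ->
  measurable E -> 0 < mu E -> g%:E <= dimP (f @` E : set 'rV[R]_m).
Proof.
move=> [N [mN muN0 N_sub]] mE muE.
rewrite leNgt; apply/negP => /ereal_inf_lt[_ [F EF <-] supF].
have Fg i : ubox_dim (F i) < g%:E.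
  by apply: le_lt_trans supF; apply: ereal_sup_ubound; exists i.
have [V VP] := choice (fun i => ubox_dim_lower_density _ _ (Fg i)).
have mV i : measurable (V i) by case: (VP i).
suff EV : E `<=` N `|` \bigcup_i V i.
  have : mu.-negligible (N `|` \bigcup_i V i).
    apply: negligibleU; first by exists N; split.
    by apply: negligible_bigcup => i; exists (V i); split => //; case: (VP i).
  move=> /(negligibleS EV)/(measure_negligible mE) E0.
  by move: muE; rewrite E0 ltxx.
move=> t Et; have [|Nt] := pselect (N t); [by left|right].
have lim0 : limn_einf (fun k => ((2^-1 ^+ k) `^ (- g))%:E *
    mu (preball (f t) (2^-1 ^+ k)%R)) = 0.
  by apply: contrapT => ht; exact/Nt/N_sub.
have [i _ Fit] := EF (f t) (ex_intro2 _ _ t Et erefl).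
exists i => //; apply: contrapT => nVt.
have [_ _ /(_ t Fit nVt)[K KP]] := VP i.
(* The threshold is 2^(-g): the density bound at scale k+1 concerns the ball of radius 2^(-k) and
   gives it mass at least 2^(-g) (2^(-k))^g. *)
have c0 : (0 < 2^-1 `^ g :> R)%R by rewrite powR_gt0// invr_gt0.
have [|k Kk] := (limn_einf_eq0P _ _).1 lim0 K _ c0.
  by move=> k; rewrite mule_ge0// lee_fin powR_ge0.
apply/negP; rewrite -leNgt.
have := KP k.+1 (leqW Kk); rewrite exprS mulrA divff// mul1r => le_ball.
apply: (@le_trans _ _ (((2^-1 ^+ k) `^ (- g))%:E * ((2^-1 * 2^-1 ^+ k) `^ g)%:E));
  last by apply: lee_pmul => //; rewrite lee_fin powR_ge0.
rewrite -EFinM lee_fin powRM ?invr_ge0 ?(ltW (half_pow_gt0 _))//.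
rewrite mulrCA -powRD ?addNr ?powRr0 ?mulr1//.
by rewrite (gt_eqF (half_pow_gt0 _)) implybT.
Qed.

End packing_dimension.

(** * Joint measurability of ball masses and exchange of null sets *)

Section random_map.
Context {R : realType} {n m : nat} {d : measure_display}.
Context {Omega : measurableType d} (P : probability Omega R).
Variable Z : Rn R n -> Omega -> Rn R m.
Hypothesis Zmeas : measurable_fun [set: (Rn R n * Omega)%type]
  (fun p => Z p.1 p.2).

Lemma measurable_sample_map (w : Omega) : measurable_fun [set: Rn R n] (Z ^~ w).
Proof.
rewrite (_ : Z ^~ w = (fun p => Z p.1 p.2) \o (fun t => (t, w)))//.
exact: (measurableT_comp Zmeas (measurable_pair2 w)).
Qed.

Variable mu : probability (Rn R n) R.

Local Notation mass r t w :=
  (pushforward mu (Z ^~ w) (cball (Z t w : 'rV[R]_m) r : set (Rn R m))).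

(** The mass at (t, w) is the [mu]-measure of a section of one measurable set [A] of triples ((t,
    w), s), so measurability of section measures applies. *)
Lemma measurable_mass (r : R) :
  measurable_fun [set: (Rn R n * Omega)%type] (fun p => mass r p.1 p.2).
Proof.
pose A := [set q : (Rn R n * Omega) * Rn R n |
  (edist (Z q.1.1 q.1.2 : 'rV[R]_m) (Z q.2 q.1.2 : 'rV[R]_m) <= r)%R].
have mA : measurable A.
  have mf : measurable_fun [set: ((Rn R n * Omega) * Rn R n)%type]
    (fun q => Z q.1.1 q.1.2) by exact: (measurableT_comp Zmeas measurable_fst).
  have mg : measurable_fun [set: ((Rn R n * Omega) * Rn R n)%type]
      (fun q => Z q.2 q.1.2).
    have mp : measurable_fun [set: ((Rn R n * Omega) * Rn R n)%type]
        (fun q => (q.2, q.1.2)).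
      apply: measurable_fun_pair; first exact: measurable_snd.
      exact: (measurableT_comp measurable_snd measurable_fst).
    exact: (measurableT_comp Zmeas mp).
  have := measurable_edist _ _ mf mg measurableT _ (measurable_itv `]-oo, r]%R).
  by rewrite setTI.
rewrite (_ : (fun p => _) = mu \o xsection A).
  exact: measurable_fun_xsection.
apply/funext => p /=; congr (mu _).
by apply/seteqP; split => s /=; rewrite /xsection/= inE.
Qed.

Lemma mass_ge0 (r : R) (t : Rn R n) (w : Omega) : 0 <= mass r t w.
Proof. by rewrite /pushforward. Qed.

Lemma mass_homo (t : Rn R n) (w : Omega) :
  {homo (fun r => mass r t w) : r s / (r <= s)%R >-> r <= s}.
Proof.
move=> r s rs; rewrite /pushforward; apply: le_measure; rewrite ?inE.
- exact: (measurable_preball _ (measurable_sample_map w)).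
- exact: (measurable_preball _ (measurable_sample_map w)).
- by move=> u /= /le_trans; apply.
Qed.

Lemma measurable_mass_section (r : R) (t : Rn R n) :
  measurable_fun [set: Omega] (fun w => mass r t w).
Proof. exact: (measurableT_comp (measurable_mass r) (measurable_pair1 t)). Qed.

(* Fatou turns smallness of the expectations into almost sure smallness for
   almost every [t], and Tonelli exchanges the two exceptional null sets. *)
Lemma ae_dyadic_mass_liminf (g : R) : (0 <= g)%R ->
  {ae mu, forall t, limf_einf
     (fun r : R => (r `^ (- g))%:E * exp_ball P Z mu t r) (0%R^'+) = 0} ->
  {ae P, forall w, {ae mu, forall t, limn_einf
     (fun k => ((2^-1 ^+ k) `^ (- g))%:E * mass (2^-1 ^+ k)%R t w) = 0}}.
Proof.
move=> g0 ae_lim.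
pose u k (p : Rn R n * Omega) :=
  ((2^-1 ^+ k) `^ (- g))%:E * mass (2^-1 ^+ k)%R p.1 p.2.
have u0 k p : 0 <= u k p by rewrite mule_ge0 ?lee_fin ?powR_ge0 ?mass_ge0.
have mu_ k : measurable_fun setT (u k).
  by apply: measurable_funeM; exact: measurable_mass.
pose h p := limn_einf (u ^~ p).
have mh : measurable_fun setT h.
  apply: measurableT_comp => //.
  by apply: measurable_fun_limn_esup => k; exact: measurableT_comp.
have h0 p : 0 <= h p.
  rewrite /h limn_einf_lim (cvg_lim _ (@cvg_einfs_sup _ _))//.
  apply: le_trans (ereal_sup_ubound _); last by exists 0%N.
  by apply: le_ereal_inf_tmp => _ [k _ <-].
have ae_int : {ae mu, forall t, \int[P]_w h (t, w) = 0}.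
  apply: filterS ae_lim => t /dyadic_limn_einf lim0.
  apply/eqP; rewrite eq_le integral_ge0// andbT.
  apply: le_trans (fatou P measurableT _ _) _ => //.
    by move=> k; exact: (measurableT_comp (mu_ k) (measurable_pair1 t)).
  rewrite -(lim0 g0).
  - rewrite le_eqVlt; apply/orP; left; apply/eqP; congr limn_einf.
    apply/funext => k; rewrite /u/= ge0_integralZl//.
    + exact: measurable_mass_section.
    + by move=> w _; exact: mass_ge0.
  - by move=> r; apply: integral_ge0 => w _; exact: mass_ge0.
  - move=> r s rs; apply: ge0_le_integral => //.
    + by move=> w _; exact: mass_ge0.
    + exact: measurable_mass_section.
    + exact: measurable_mass_section.
    + by move=> w _; exact: mass_homo.
have mF := measurable_fun_fubini_tonelli_F (m2 := P) h mh h0.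
have mG := measurable_fun_fubini_tonelli_G (m1 := mu) h mh h0.
have int0 : \int[P]_w \int[mu]_t h (t, w) = 0.
  rewrite -(fubini_tonelli h mh h0).
  rewrite (ge0_ae_eq_integral _ mF (measurable_cst 0))//.
  - by rewrite integral0.
  - by move=> t _; exact: integral_ge0.
  - by apply: filterS ae_int => t ht _.
(* A nonnegative function of zero integral vanishes almost everywhere: used first in [w] for the
   inner integral, then in [t] for each good [w]. *)
have : {ae P, forall w, \int[mu]_t h (t, w) = 0}.
  have : ae_eq P setT (fun w => \int[mu]_t h (t, w)) (cst 0).
    apply/(ae_eq_integral_abs _ measurableT mG).
    rewrite -[RHS]int0; apply: eq_integral => w _.
    by rewrite gee0_abs// integral_ge0.
  by apply: filterS => w; apply.
apply: filterS => w hw.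
have : ae_eq mu setT (fun t => h (t, w)) (cst 0).
  apply/(ae_eq_integral_abs _ measurableT).
    exact: (measurableT_comp mh (measurable_pair2 w)).
  rewrite -[RHS]hw; apply: eq_integral => t _.
  by rewrite gee0_abs.
by apply: filterS => t; apply.
Qed.

End random_map.

(** [N] is the union of the null balls with rational centre and dyadic radius, a countable family;
    every point outside the support lies in one of them. *)
Lemma supp_conull {R : realType} {n : nat} (mu : probability (Rn R n) R) :
  exists N : set (Rn R n), [/\ measurable N, mu N = 0 & ~` N `<=` supp mu].
Proof.
pose ball (p : 'rV[rat]_n * nat) : set (Rn R n) :=
  cball (map_mx ratr p.1) (2^-1 ^+ p.2)%R.
(* Indices that decode to no ball, or to a ball of positive mass, contribute the empty set. *)
pose B i : set (Rn R n) := if unpickle i is Some p then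
  if mu (ball p) == 0 then ball p else set0 else set0.
have mB i : measurable (B i).
  rewrite /B; case: unpickle => // p; case: ifP => // _.
  exact: measurable_cball.
exists (\bigcup_i B i); split.
- exact: bigcup_measurable.
- apply: measure_negligible; first exact: bigcup_measurable.
  apply: negligible_bigcup => i; apply/negligibleP => //.
  by rewrite /B; case: unpickle => [p|]; [case: ifP => [/eqP|]|]; rewrite ?measure0.
- move=> x notN r r0; rewrite lt_neqAle measure_ge0 andbT.
  apply/negP => /eqP/esym ball0; apply: notN.
  (* With 2^(-k) < r / 2, a ball of radius 2^(-k) containing [x] lies inside the null ball of radius
     [r] about [x]. *)
  have [k kr] := half_pow_lt _ (divr_gt0 r0 (ltr0Sn R 1)).
  have {}kr := kr k (leqnn k).
  have [c cx] := dense_rat_edist x (2^-1 ^+ k)%R (half_pow_gt0 k).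
  exists (pickle (c, k)) => //; rewrite /B pickleK.
  suff -> : mu (ball (c, k)) = 0 by rewrite eqxx.
  apply/eqP; rewrite eq_le measure_ge0 andbT -ball0.
  apply: le_measure; rewrite ?inE; try exact: measurable_cball.
  move=> y /= cy; rewrite /cball/=.
  apply: (@le_trans _ _ (2 * 2^-1 ^+ k)%R).
    by apply: edist_le_double cy; rewrite edistC.
  by rewrite mulrC -ler_pdivlMr// ltW.
Qed.

Lemma dimP_homo {R : realType} {m : nat} :
  {homo @dimP R m : E F / E `<=` F >-> E <= F}.
Proof.
move=> E F EF; apply: ereal_inf_le_tmp => _ [G FG <-].
by exists G => //; exact: subset_trans FG.
Qed.

(** [S] may be uncountable, so its null sets cannot simply be united; a sequence in [S] converging
    to the supremum leaves countably many. *)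
Lemma ae_ereal_sup_le {R : realType} {d : measure_display}
    {Omega : measurableType d} (P : probability Omega R)
    (S : set (\bar R)) (X : Omega -> \bar R) :
  (forall s, S s -> {ae P, forall w, s <= X w}) ->
  {ae P, forall w, ereal_sup S <= X w}.
Proof.
move=> SX; have [->|/ereal_sup_seq[u Su u_sup]] := eqVneq S set0.
  by apply: aeW => w; rewrite ereal_sup0 leNye.
apply: filterS (ae_foralln (fun i => SX _ (Su i))) => w uX.
rewrite -(cvg_lim _ u_sup)//; apply: lime_le.
  by apply/cvg_ex; eexists; exact: u_sup.
exact: nearW.
Qed.

(** * Almost sure lower bounds for the dimensions of image measures and image sets *)

Section random_map_dimension.
Context {R : realType} {n m : nat} {d : measure_display}.
Context {Omega : measurableType d} (P : probability Omega R).
Variable Z : Rn R n -> Omega -> Rn R m.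
Hypothesis Zmeas : measurable_fun [set: (Rn R n * Omega)%type]
  (fun p => Z p.1 p.2).

(** Common source of both inequalities: one null set of [w] serves all sets [E] of positive measure
    at once. *)
Lemma ae_dimPZ_le_image (mu : probability (Rn R n) R) :
  {ae P, forall w, dimPZ P Z mu <= ereal_inf
    [set dimP ((Z ^~ w) @` E : set 'rV[R]_m) | E in
      [set E | measurable E /\ 0 < mu E]]}.
Proof.
apply: ae_ereal_sup_le => _ [g ae_lim <-].
(* The dyadic comparison requires g >= 0; for negative [g] the bound follows from nonnegativity of
   [dimP]. *)
have [g0|g0] := leP 0%R g; last first.
  apply: aeW => w; apply: le_ereal_inf_tmp => _ [E _ <-].
  by apply: le_trans (dimP_ge0 _); rewrite lee_fin ltW.
apply: filterS (ae_dyadic_mass_liminf P Z Zmeas mu g g0 ae_lim) => w ae_mass.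
apply: le_ereal_inf_tmp => _ [E [mE muE] <-].
exact: (dimP_image_ge mu _ (measurable_sample_map Z Zmeas w)).
Qed.

Lemma ae_dimPZ_le_dimP_meas (mu : probability (Rn R n) R) :
  {ae P, forall w, dimPZ P Z mu <= dimP_meas (pushforward mu (Z ^~ w))}.
Proof.
apply: filterS (ae_dimPZ_le_image mu) => w /le_trans; apply.
apply: le_ereal_inf_tmp => _ [E [mE muE] <-].
(* The preimage of [E] has positive [mu]-measure, and its image lies in [E]. *)
apply: (@le_trans _ _ (dimP ((Z ^~ w) @` ((Z ^~ w) @^-1` E) : set 'rV[R]_m)));
  last by apply: dimP_homo; exact: image_preimage_subset.
apply: ereal_inf_lbound; exists (Z ^~ w @^-1` E) => //; split => //.
by rewrite -[X in measurable X]setTI; exact: measurable_sample_map.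
Qed.

Lemma ae_dimPZ_set_le_dimP (A : set 'rV[R]_n) :
  {ae P, forall w, dimPZ_set P Z A <= dimP ((Z ^~ w) @` A : set 'rV[R]_m)}.
Proof.
apply: ae_ereal_sup_le => _ [mu [_ suppA] <-].
have [N [mN muN0 N_supp]] := supp_conull mu.
apply: filterS (ae_dimPZ_le_image mu) => w /le_trans; apply.
(* The complement of [N] is measurable, of full measure and contained in [supp mu], hence in [A]. *)
apply: (@le_trans _ _ (dimP ((Z ^~ w) @` (~` N) : set 'rV[R]_m)));
  last by apply/dimP_homo/image_subset/(subset_trans N_supp).
apply: ereal_inf_lbound; exists (~` N) => //; split; first exact: measurableC.
by rewrite probability_setC// muN0 sube0.
Qed.

End random_map_dimension.

Theorem theorem1p2 (R : realType) (n m : nat)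
  (d : measure_display) (Omega : measurableType d) (P : probability Omega R)
  (Z : Rn R n -> Omega -> Rn R m)
  (Zmeas : measurable_fun [set: (Rn R n * Omega)%type] (fun p => Z p.1 p.2))
  (mu : probability (Rn R n) R) (mu_Pc : Pc [set: 'rV[R]_n] mu)
  (A : set 'rV[R]_n) (A_analytic : analytic A) :
  {ae P, forall w,
     dimPZ P Z mu <= dimP_meas (pushforward mu (Z ^~ w)) /\
     dimPZ_set P Z A <= dimP ((Z ^~ w) @` A : set 'rV[R]_m)}.
Proof.
have := ae_dimPZ_set_le_dimP P Z Zmeas A.
by apply: filterS2 (ae_dimPZ_le_dimP_meas P Z Zmeas mu) => w.
Qed.
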